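(* Let $m,r,s\ge 1$ be integers, let $A\in (C^{(s-1)})^{m\times m}$, and let $B\colon (C^{(s)})^{m}\to\mathbb{C}^{r}$ be an arbitrary continuous linear operator. Put $(Ly)(t):=y'(t)+A(t)y(t)$ for $y\in (C^{(s)})^m$. Then the linear operator $$(L,B)\colon (C^{(s)})^m\to (C^{(s-1)})^m\times\mathbb{C}^r,\qquad y\mapsto (Ly,By),$$ is bounded and Fredholm, with index $m-r$.
   Context: Fix a finite interval $[a,b]$, $a<b$. $C^{(0)}$ is the complex Banach space of continuous functions $x\colon[a,b]\to\mathbb{C}$ with norm $\|x\|_{(0)}=\max_{[a,b]}|x(t)|$; for $l\in\mathbb{N}$, $l\ge1$, $C^{(l)}$ is the complex Banach space of $l$ times continuously differentiable functions $x\colon[a,b]\to\mathbb{C}$ with norm $\|x\|_{(l)}=\sum_{j=0}^{l}\|x^{(j)}\|_{(0)}$. $(C^{(l)})^m$ denotes the space of (column) vector-valued functions with $m$ components in $C^{(l)}$, with norm the sum of the norms of the components; $(C^{(l)})^{m\times m}$ denotes the space of $m\times m$ matrix-valued functions with entries in $C^{(l)}$, with norm the maximum of the norms of its columns in $(C^{(l)})^m$. The space $(C^{(s-1)})^m\times\mathbb{C}^r$ carries any standard product norm. A continuous linear operator $T\colon X\to Y$ between Banach spaces is called Fredholm if its kernel $\ker T$ and cokernel $Y/T(X)$ are finite-dimensional; its index is $\operatorname{ind}T:=\dim\ker T-\dim(Y/T(X))$. *)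

(* Defs.v *)
From HB Require Import structures.
From mathcomp Require Import all_boot all_order all_algebra.
From mathcomp Require Import all_classical all_reals.
From mathcomp Require Import topology normedtype.
From mathcomp Require Import complex.
From mathcomp Require Import generic_quotient ring_quotient.

Set Implicit Arguments.
Unset Strict Implicit.
Unset Printing Implicit Defensive.

Import Order.TTheory GRing.Theory Num.Theory.
Export numFieldNormedType.Exports.

Local Open Scope classical_set_scope.
Local Open Scope ring_scope.
Local Open Scope complex_scope.

(* Stating R[i] at this type gives it the modulus topology that the library
   puts on every numClosedFieldType. *)
Definition Cx (R : realType) : numClosedFieldType := R[i].

Section Dimension.
Variables (K : fieldType) (V : lmodType K).

(* Vector.axiom n V: there is a linear bijection V -> 'rV[K]_n. *)
Definition has_dim (n : nat) : Prop := inhabited (Vector.axiom n V).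

Definition finite_dim : Prop := exists n, has_dim n.

(* The dimension, and 0 if V is infinite-dimensional. *)
Definition dimension : nat := xget 0%N [set n | has_dim n].

End Dimension.

Section Kernel.
Variables (K : fieldType) (X Y : lmodType K) (T : {linear X -> Y}).

Definition ker_pred : {pred X} := fun x => T x == 0.

Fact ker_pred_submod_closed : submod_closed ker_pred.
Proof.
split; first by rewrite unfold_in linear0.
by move=> k u v /eqP Tu /eqP Tv; rewrite unfold_in linearP Tu Tv scaler0 addr0.
Qed.
HB.instance Definition _ :=
  GRing.isSubmodClosed.Build K X ker_pred ker_pred_submod_closed.

Definition ker_space := {x : X | x \in ker_pred}.
HB.instance Definition _ := [isSub of ker_space for sval].
HB.instance Definition _ := [Choice of ker_space by <:].
HB.instance Definition _ := [SubChoice_isSubLmodule of ker_space by <:].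

End Kernel.

Section Cokernel.
Local Open Scope quotient_scope.
Variables (K : fieldType) (X Y : lmodType K) (T : {linear X -> Y}).

Definition im_pred : {pred Y} := fun y => y \in range T.

Fact im_pred_zmod_closed : zmod_closed im_pred.
Proof.
split; first by rewrite unfold_in inE; exists 0 => //; rewrite linear0.
move=> u v; rewrite !unfold_in !inE => -[x _ <-] [y _ <-].
by exists (x - y) => //; rewrite linearB.
Qed.
HB.instance Definition _ :=
  GRing.isZmodClosed.Build Y im_pred im_pred_zmod_closed.

(* The quotient Y / T(X); the library gives its group structure, and scalar
   multiplication is induced from that of Y. *)
Definition coker_space := Quotient.quot im_pred.
HB.instance Definition _ := GRing.Zmodule.on coker_space.
HB.instance Definition _ := EqQuotient.on coker_space.

Definition scale_coker (k : K) (u : coker_space) : coker_space :=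
  \pi_coker_space (k *: repr u).

Lemma pi_cokerD (x y : Y) :
  \pi_coker_space (x + y) = \pi_coker_space x + \pi_coker_space y.
Proof. exact: (@pi_addr _ _ _ _ _ (Quotient.quot im_pred)). Qed.

Lemma pi_scale_coker k y :
  \pi_coker_space (k *: y) = scale_coker k (\pi_coker_space y).
Proof.
rewrite /scale_coker; apply/eqP; rewrite -Quotient.idealrBE -scalerBr.
have : y - repr (\pi_coker_space y) \in im_pred.
  by rewrite Quotient.idealrBE reprK.
by rewrite !unfold_in !inE => -[x _ <-]; exists (k *: x) => //; rewrite linearZ.
Qed.

Fact scale_cokerA k l u :
  scale_coker k (scale_coker l u) = scale_coker (k * l) u.
Proof.
rewrite -[u]reprK -(pi_scale_coker l) -(pi_scale_coker k).
by rewrite -(pi_scale_coker (k * l)) scalerA.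
Qed.

Fact scale_coker1 : left_id 1 scale_coker.
Proof. by move=> u; rewrite -[u]reprK -!pi_scale_coker scale1r. Qed.

Fact scale_cokerDr : right_distributive scale_coker +%R.
Proof.
move=> k u v; rewrite -[u]reprK -[v]reprK -pi_cokerD -!pi_scale_coker.
by rewrite -pi_cokerD scalerDr.
Qed.

Fact scale_cokerDl u : {morph scale_coker^~ u : k l / k + l}.
Proof.
by move=> k l; rewrite -[u]reprK -!pi_scale_coker -pi_cokerD scalerDl.
Qed.

HB.instance Definition _ := GRing.Zmodule_isLmodule.Build K coker_space
  scale_cokerA scale_coker1 scale_cokerDr scale_cokerDl.

End Cokernel.

Section Fredholm.
Variables (K : numFieldType) (X Y : normedModType K) (T : {linear X -> Y}).

Definition bounded_operator : Prop :=
  exists M : K, forall x : X, `|T x| <= M * `|x|.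

Definition fredholm : Prop :=
  [/\ continuous T, finite_dim (ker_space T) & finite_dim (coker_space T)].

Definition fredholm_index : int :=
  (dimension (ker_space T))%:Z - (dimension (coker_space T))%:Z.

End Fredholm.

Section Modulus.
Variable R : realType.
Notation C := (Cx R).

(* The modulus as an element of R; `|z| is its image in C. *)
Definition modulus (z : C) : R := complex.Re `|z|.

Lemma normCE (z : C) : `|z| = (modulus z)%:C :> R[i].
Proof. by []. Qed.

Lemma modulusD (z w : C) : modulus (z + w) <= modulus z + modulus w.
Proof. by rewrite -lecR rmorphD -!normCE; exact: ler_normD. Qed.

Lemma modulusM (z w : C) : modulus (z * w) = modulus z * modulus w.
Proof. by apply: complexI; rewrite rmorphM -!normCE; exact: normrM. Qed.

Lemma modulus_ge0 (z : C) : 0 <= modulus z.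
Proof. by rewrite -lecR -normCE; exact: normr_ge0. Qed.

Lemma modulus_eq0 (z : C) : modulus z = 0 -> z = 0.
Proof. by move=> z0; apply/normr0_eq0; rewrite normCE z0. Qed.

Lemma modulus_dist (z w : C) : `|modulus z - modulus w| <= modulus (z - w).
Proof.
have tri (u v : C) : modulus u - modulus v <= modulus (u - v).
  by rewrite lerBlDr; have := modulusD (u - v) v; rewrite subrK.
rewrite ler_norml tri andbT lerNl opprB.
have -> : modulus (z - w) = modulus (w - z).
  by apply: complexI; rewrite -!normCE; exact: distrC.
exact: tri.
Qed.

Lemma modulus_continuous : continuous modulus.
Proof.
move=> z; apply/(cvgrPdist_lt (FF := nbhs_filter z)) => e e0.
have e0' : 0 < (e%:C : C) by rewrite ltcR.
apply: filterS (nbhsx_ballx z _ e0') => w; rewrite -ball_normE/= normCE ltcR.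
exact/le_lt_trans/modulus_dist.
Qed.

End Modulus.
Arguments modulus {R} z.

#[local] Opaque Cx.

Section Derivative.
Variables (R : realType) (a b : R).
Notation C := (Cx R).

(* The type of points of [a, b], with the topology induced by R. *)
Notation I := (set_type `[a, b]%classic).
Implicit Types (x y : I -> C) (t u : I).

(* Limits in t^' are taken over points of [a, b] other than t, so derivatives
   at the endpoints are one-sided. *)
Definition diff_quot x t (u : I) : C := (x u - x t) / (\val u - \val t)%:C.
Definition differentiable_at x t : Prop := cvg (diff_quot x t u @[u --> t^']).
Definition derivative x : I -> C := fun t => lim (diff_quot x t u @[u --> t^']).

Definition nderiv (j : nat) x : I -> C := iter j derivative x.

Definition is_Ck (l : nat) x : Prop :=
  (forall j, (j < l)%N -> forall t, differentiable_at (nderiv j x) t) /\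
  (forall j, (j <= l)%N -> continuous (nderiv j x)).

Lemma is_Ck0 x : is_Ck 0 x <-> continuous x.
Proof.
split=> [[_ cx]|cx]; first exact: (cx 0%N (leqnn 0)).
split=> [j j0|j]; first by exfalso; move: j0; rewrite ltn0.
by rewrite leqn0 => /eqP ->; exact: cx.
Qed.

Lemma is_CkS l x : is_Ck l.+1 x <->
  [/\ (forall t, differentiable_at x t), continuous x & is_Ck l (derivative x)].
Proof.
have nS j : nderiv j (derivative x) = nderiv j.+1 x by rewrite /nderiv iterSr.
split=> [[dx cx]|[dx cx [dx' cx']]].
- split; [exact: (dx 0%N)|exact: (cx 0%N)|split=> j jl]; rewrite nS.
  + exact: dx.
  + exact: cx.
- split=> -[|j] jl; [exact: dx|rewrite -nS; exact: dx'|exact: cx|].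
  by rewrite -nS; exact: cx'.
Qed.

Lemma is_CkW l x : is_Ck l.+1 x -> is_Ck l x.
Proof.
case=> dx cx; split=> j jl; first exact: (dx j (leqW jl)).
exact: (cx j (leqW jl)).
Qed.

Hypothesis hab : a < b.

Lemma dnbhs_segment_proper t : ProperFilter t^'.
Proof.
apply: Build_ProperFilter_ex => A.
rewrite /dnbhs /within /= => /nbhs_ballP[e /= e0 tA].
have := valP t; rewrite inE/= in_itv/= => /andP[at_ tb].
suff [u [uI ut ue]] : exists u : R,
    [/\ u \in `[a, b]%classic, u != \val t & `|\val t - u| < e].
  exists (exist _ u uI); apply: tA; first exact: ue.
  by apply: contra_neq ut => <-.
have [ltb|] := ltP (\val t) b.
- exists (Num.min b (\val t + e / 2)); split.
  + rewrite inE/= in_itv/= ge_min lexx/= andbT le_min (ltW hab)/=.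
    by rewrite (le_trans at_)// lerDl divr_ge0// ltW.
  + by rewrite gt_eqF// lt_min ltb ltrDl divr_gt0.
  + rewrite distrC ger0_norm; last first.
      by rewrite subr_ge0 le_min tb lerDl divr_ge0// ltW.
    rewrite ltrBlDl gt_min; apply/orP; right.
    by rewrite ltrD2l ltr_pdivrMr// ltr_pMr// ltr1n.
- move=> bt; have lta : a < \val t by exact: lt_le_trans bt.
  exists (Num.max a (\val t - e / 2)); split.
  + rewrite inE/= in_itv/= le_max lexx/= ge_max (ltW hab)/=.
    by rewrite (le_trans _ tb)// lerBlDr lerDl divr_ge0// ltW.
  + by rewrite lt_eqF// gt_max lta/= ltrBlDr ltrDl divr_gt0.
  + rewrite ger0_norm; last first.
      by rewrite subr_ge0 ge_max at_/= lerBlDr lerDl divr_ge0// ltW.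
    rewrite ltrBlDr -ltrBlDl lt_max; apply/orP; right.
    by rewrite ltrD2l ltrN2 ltr_pdivrMr// ltr_pMr// ltr1n.
Qed.

Lemma deriv_unique x t l :
  diff_quot x t u @[u --> t^'] --> l ->
  differentiable_at x t /\ derivative x t = l.
Proof.
move=> xl; have tP := dnbhs_segment_proper t.
split; first by apply/cvg_ex; exists l.
exact: (@cvg_lim _ (@norm_hausdorff _ _) _ _ tP _ _ xl).
Qed.

Lemma differentiable_cvg x t :
  differentiable_at x t -> diff_quot x t u @[u --> t^'] --> derivative x t.
Proof. by []. Qed.

Lemma derivP k x y t : differentiable_at x t -> differentiable_at y t ->
  differentiable_at (k *: x + y) t /\
  derivative (k *: x + y) t = k * derivative x t + derivative y t.
Proof.
move=> /differentiable_cvg dx /differentiable_cvg dy; apply: deriv_unique.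
have -> : diff_quot (k *: x + y) t =
    (fun u => k * diff_quot x t u) + diff_quot y t.
  apply/funext => u; rewrite /diff_quot !fctE/= mulrA -mulrDl.
  by congr (_ / _); rewrite opprD addrACA -mulrBr.
exact: (cvgD (cvgM (cvg_cst k) dx) dy).
Qed.

Lemma derivM x y t : continuous x ->
  differentiable_at x t -> differentiable_at y t ->
  differentiable_at (fun u => x u * y u) t /\
  derivative (fun u => x u * y u) t =
    x t * derivative y t + derivative x t * y t.
Proof.
move=> cx /differentiable_cvg dx /differentiable_cvg dy; apply: deriv_unique.
have -> : diff_quot (fun u => x u * y u) t =
    (fun u => x u * diff_quot y t u) + (fun u => diff_quot x t u * y t).
  apply/funext => u; rewrite /diff_quot !fctE/=.
  rewrite [in RHS]mulrA [X in _ = _ + X]mulrAC -mulrDl.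
  by congr (_ / _); rewrite mulrBr mulrBl addrA subrK.
have cxt : x u @[u --> t^'] --> x t.
  by apply: cvg_trans (cx t); apply: cvg_app; exact: nbhs_dnbhs.
exact: (cvgD (cvgM cxt dy) (cvgM dx (cvg_cst (y t)))).
Qed.

Lemma is_Ck_lin l k x y : is_Ck l x -> is_Ck l y -> is_Ck l (k *: x + y).
Proof.
elim: l x y => [|l IHl] x y.
  move=> /is_Ck0 cx /is_Ck0 cy; apply/is_Ck0 => t.
  exact: (cvgD (cvgM (cvg_cst k) (cx t)) (cy t)).
move=> /is_CkS[dx cx x'l] /is_CkS[dy cy y'l]; apply/is_CkS; split.
- by move=> t; have [] := derivP k (dx t) (dy t).
- by move=> t; exact: (cvgD (cvgM (cvg_cst k) (cx t)) (cy t)).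
- have -> : derivative (k *: x + y) = k *: derivative x + derivative y.
    by apply/funext => t; have [] := derivP k (dx t) (dy t).
  exact: IHl.
Qed.

Lemma is_Ck_0 l : is_Ck l (0 : I -> C).
Proof.
have c0 : continuous (0 : I -> C) by exact: (@cst_continuous I C 0).
elim: l => [|l IHl]; first exact/is_Ck0.
have d0 t : differentiable_at 0 t /\ derivative 0 t = 0.
  apply: deriv_unique.
  have -> : diff_quot 0 t = cst 0; last exact: (@cvg_cst C 0).
  by apply/funext => u; rewrite /diff_quot subrr mul0r.
apply/is_CkS; split; [by move=> t; case: (d0 t)|exact: c0|].
by have -> : derivative 0 = 0 by apply/funext => t; case: (d0 t).
Qed.

Lemma is_CkM l x y : is_Ck l x -> is_Ck l y -> is_Ck l (fun t => x t * y t).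
Proof.
elim: l x y => [|l IHl] x y.
  move=> /is_Ck0 cx /is_Ck0 cy; apply/is_Ck0 => t.
  exact: (cvgM (cx t) (cy t)).
move=> xl yl; have xl' := is_CkW xl; have yl' := is_CkW yl.
move: xl yl => /is_CkS[dx cx x'l] /is_CkS[dy cy y'l]; apply/is_CkS; split.
- by move=> t; have [] := derivM cx (dx t) (dy t).
- by move=> t; exact: (cvgM (cx t) (cy t)).
- have -> : derivative (fun t => x t * y t) =
      1 *: (fun t => x t * derivative y t) + (fun t => derivative x t * y t).
    apply/funext => t; have [_ ->] := derivM cx (dx t) (dy t).
    by rewrite !fctE/= scale1r.
  by apply: is_Ck_lin; exact: IHl.
Qed.

Lemma nderivP l j k x y : (j <= l)%N -> is_Ck l x -> is_Ck l y ->
  nderiv j (k *: x + y) = k *: nderiv j x + nderiv j y.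
Proof.
elim: j => [//|j IHj] jl xl yl; rewrite /nderiv !iterS -!/(nderiv _ _).
rewrite IHj//; last exact: ltnW.
by apply/funext => t; have [] := derivP k (xl.1 j jl t) (yl.1 j jl t).
Qed.

(* By compactness this is the maximum of the modulus when x is continuous. *)
Definition supnorm x : R := sup (range (modulus \o x)).

Let I_ne x : range (modulus \o x) !=set0.
Proof.
have aI : a \in `[a, b]%classic by rewrite inE/= in_itv/= lexx ltW.
by exists (modulus (x (exist _ a aI))), (exist _ a aI).
Qed.

Lemma supnorm_ubound x : continuous x -> has_ubound (range (modulus \o x)).
Proof.
move=> cx; have cmx : continuous (modulus \o x).
  by move=> t; exact: continuous_comp (cx t) (@modulus_continuous _ (x t)).
have /subspace_valL_continuousP' cv := cmx.
have := compact_bounded (continuous_compact (cv 0) (@segment_compact _ a b)).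
move=> [M [_ /(_ (M + 1))]]; rewrite ltrDl ltr01 => /(_ isT) bM.
exists (M + 1) => _ [t _ <-]; apply: le_trans (ler_norm _) _; apply: bM.
exists (\val t); first exact: set_valP.
exact: (congr1 (@^~ t) (@valLK _ _ 0 _ (modulus \o x))).
Qed.

Lemma le_supnorm x t : continuous x -> modulus (x t) <= supnorm x.
Proof. by move=> /supnorm_ubound/ub_le_sup; apply; exists t. Qed.

Lemma supnormD x y : continuous x -> continuous y ->
  supnorm (x + y) <= supnorm x + supnorm y.
Proof.
move=> cx cy; apply: ge_sup (I_ne _) _ => _ [t _ <-] /=.
by apply: le_trans (modulusD _ _) _; apply: lerD; exact: le_supnorm.
Qed.

Lemma supnormZ k x : continuous x -> supnorm (k *: x) = modulus k * supnorm x.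
Proof.
move=> cx; have kx t : modulus ((k *: x) t) = modulus k * modulus (x t).
  exact: modulusM.
have ub : ubound (range (modulus \o (k *: x))) (modulus k * supnorm x).
  by move=> _ [t _ <-]; rewrite /= kx ler_wpM2l ?modulus_ge0// le_supnorm.
apply/eqP; rewrite eq_le (ge_sup (I_ne _) ub)/=.
have [k0|] := eqVneq (modulus k) 0.
  rewrite k0 mul0r; have [_ [t _ _]] := I_ne x.
  apply: le_trans (modulus_ge0 ((k *: x) t)) _.
  by apply: ub_le_sup; [exists (modulus k * supnorm x)|exists t].
move=> k0; have kgt0 : 0 < modulus k by rewrite lt0r k0 modulus_ge0.
rewrite mulrC -ler_pdivlMr//; apply: ge_sup (I_ne _) _ => _ [t _ <-] /=.
rewrite ler_pdivlMr// mulrC -kx.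
by apply: ub_le_sup; [exists (modulus k * supnorm x)|exists t].
Qed.

Lemma supnorm_ge0 x : continuous x -> 0 <= supnorm x.
Proof.
move=> cx; have [_ [t _ _]] := I_ne x.
exact: le_trans (modulus_ge0 _) (le_supnorm t cx).
Qed.

Lemma supnorm_eq0 x : continuous x -> supnorm x = 0 -> x = 0.
Proof.
move=> cx x0; apply/funext => t; apply/modulus_eq0/eqP.
by rewrite eq_le modulus_ge0 -x0 le_supnorm.
Qed.

End Derivative.

(* C^(l) on [a, b], for l >= 0. The proof of a < b is a parameter of the type
   because the normed space structure needs it. *)
Definition Ck_pred (R : realType) (a b : R) (hab : a < b) (l : nat) :
    {pred (set_type `[a, b]%classic -> Cx R)} :=
  fun x => `[< is_Ck l x >].

Record Ckspace (R : realType) (a b : R) (hab : a < b) (l : nat) := MkCk {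
  Ckfun :> set_type `[a, b]%classic -> Cx R;
  CkfunP : Ckfun \in Ck_pred hab l
}.

Section Ckspace_normed.
Variables (R : realType) (a b : R) (hab : a < b) (l : nat).
Notation C := (Cx R).
Notation I := (set_type `[a, b]%classic).

Fact Ck_pred_submod_closed : submod_closed (Ck_pred hab l).
Proof.
split; first by apply/asboolP; exact: is_Ck_0.
by move=> k x y /asboolP xl /asboolP yl; apply/asboolP; exact: is_Ck_lin.
Qed.
HB.instance Definition _ := GRing.isSubmodClosed.Build
  C (I -> C) (Ck_pred hab l) Ck_pred_submod_closed.

HB.instance Definition _ := [isSub for @Ckfun R a b hab l].
HB.instance Definition _ := [Choice of Ckspace hab l by <:].
HB.instance Definition _ := [SubChoice_isSubLmodule of Ckspace hab l by <:].

Lemma Ckspace_is_Ck (x : Ckspace hab l) : is_Ck l x.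
Proof. exact/asboolP/CkfunP. Qed.

Definition Ck_norm (x : Ckspace hab l) : C :=
  (\sum_(j < l.+1) supnorm (nderiv j x))%:C.

Let nd_cont (x : Ckspace hab l) (j : 'I_l.+1) : continuous (nderiv j x).
Proof. by apply: (Ckspace_is_Ck x).2; rewrite -ltnS. Qed.

Let nderivD (x y : Ckspace hab l) (j : 'I_l.+1) :
  nderiv j (x + y : Ckspace hab l) = nderiv j x + nderiv j y.
Proof.
have -> : Ckfun (x + y) = 1 *: Ckfun x + Ckfun y by rewrite scale1r.
rewrite (nderivP hab _ _ (Ckspace_is_Ck x) (Ckspace_is_Ck y)) ?scale1r//.
by rewrite -ltnS.
Qed.

Let nderivZ k (x : Ckspace hab l) (j : 'I_l.+1) :
  nderiv j (k *: x : Ckspace hab l) = k *: nderiv j x.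
Proof.
have jl : (j <= l)%N by rewrite -ltnS.
have nd0 : nderiv j (0 : I -> C) = 0.
  have C0 := is_Ck_0 hab l; have := nderivP hab 1 jl C0 C0.
  rewrite !scale1r addr0 => /(congr1 (+%R^~ (- nderiv j 0))).
  by rewrite addrK subrr.
have -> : Ckfun (k *: x) = k *: Ckfun x + 0 by rewrite addr0.
by rewrite (nderivP hab _ jl (Ckspace_is_Ck x) (is_Ck_0 hab l)) nd0 addr0.
Qed.

Fact Ck_normD (x y : Ckspace hab l) : Ck_norm (x + y) <= Ck_norm x + Ck_norm y.
Proof.
rewrite /Ck_norm -rmorphD lecR -big_split/=; apply: ler_sum => j _.
by rewrite nderivD; apply: supnormD => //; exact: nd_cont.
Qed.

Fact Ck_normZ (k : C) (x : Ckspace hab l) : Ck_norm (k *: x) = `|k| * Ck_norm x.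
Proof.
rewrite /Ck_norm normCE -rmorphM mulr_sumr; congr (_%:C).
by apply: eq_bigr => j _; rewrite nderivZ supnormZ//; exact: nd_cont.
Qed.

Fact Ck_norm_eq0 (x : Ckspace hab l) : Ck_norm x = 0 -> x = 0.
Proof.
move=> /complexI/eqP; rewrite psumr_eq0 => [/allP/(_ ord0)|j _]; last first.
  by apply: supnorm_ge0 => //; exact: nd_cont.
rewrite mem_index_enum => /(_ isT)/eqP /(supnorm_eq0 (@nd_cont x ord0)) x0.
exact: val_inj.
Qed.

HB.instance Definition _ := Lmodule_isNormed.Build C (Ckspace hab l)
  Ck_normD Ck_normZ Ck_norm_eq0.

End Ckspace_normed.

(* (C^(l))^m, normed below by the sum of the norms of the components. *)
Definition Ckvec (R : realType) (a b : R) (hab : a < b) (l m : nat) :=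
  {ffun 'I_m -> Ckspace hab l}.

Section Ckvec_normed.
Variables (R : realType) (a b : R) (hab : a < b) (l m : nat).
Notation C := (Cx R).

HB.instance Definition _ := GRing.Lmodule.on (Ckvec hab l m).

Definition Ckvec_norm (y : Ckvec hab l m) : C := \sum_(i < m) `|y i|.

Fact Ckvec_normD (y z : Ckvec hab l m) :
  Ckvec_norm (y + z) <= Ckvec_norm y + Ckvec_norm z.
Proof.
rewrite /Ckvec_norm -big_split/=; apply: ler_sum => i _.
by rewrite ffunE; exact: ler_normD.
Qed.

Fact Ckvec_normZ (k : C) (y : Ckvec hab l m) :
  Ckvec_norm (k *: y) = `|k| * Ckvec_norm y.
Proof.
rewrite /Ckvec_norm mulr_sumr; apply: eq_bigr => i _.
by rewrite ffunE; exact: normrZ.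
Qed.

Fact Ckvec_norm_eq0 (y : Ckvec hab l m) : Ckvec_norm y = 0 -> y = 0.
Proof.
move=> /eqP; rewrite psumr_eq0 => [/allP y0|i _]; last exact: normr_ge0.
apply/ffunP => i; rewrite ffunE; apply/normr0_eq0/eqP.
by have := y0 i; rewrite mem_index_enum; exact.
Qed.

HB.instance Definition _ := Lmodule_isNormed.Build C (Ckvec hab l m)
  Ckvec_normD Ckvec_normZ Ckvec_norm_eq0.

End Ckvec_normed.

Section Operator.
Variables (R : realType) (a b : R) (hab : a < b) (m r s : nat) (hs : (0 < s)%N).
Notation C := (Cx R).
Notation I := (set_type `[a, b]%classic).
Variable A : 'M[Ckspace hab s.-1]_m.

(* The i-th component of y' + A y. *)
Definition Lfun (y : Ckvec hab s m) (i : 'I_m) : I -> C :=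
  fun t => derivative (y i) t + \sum_(j < m) A i j t * y j t.

Fact Lfun_Ck y i : Lfun y i \in Ck_pred hab s.-1.
Proof.
apply/asboolP.
have ys j : is_Ck s.-1.+1 (y j) by rewrite prednK//; exact: Ckspace_is_Ck.
have -> : Lfun y i =
    1 *: derivative (y i) + \sum_(j < m) (fun t => A i j t * y j t).
  by apply/funext => t; rewrite /Lfun !fctE/= scale1r fct_sumE.
apply: is_Ck_lin => //; first by have /is_CkS[] := ys i.
elim/big_ind: _ => [|u v us vs|j _].
- exact: is_Ck_0.
- by rewrite -[u]scale1r; exact: is_Ck_lin.
- by apply: is_CkM => //; [exact: Ckspace_is_Ck|exact: is_CkW].
Qed.

Definition Lop (y : Ckvec hab s m) : Ckvec hab s.-1 m :=
  [ffun i => MkCk (Lfun_Ck y i)].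

Fact Lop_linear : linear Lop.
Proof.
move=> k y z; apply/ffunP => i; rewrite !ffunE; apply/val_inj/funext => t.
rewrite /= /Lfun !fctE.
have d (w : Ckvec hab s m) : differentiable_at (w i) t.
  exact: (Ckspace_is_Ck (w i)).1 0%N hs t.
rewrite !ffunE/= (derivP hab k (d y) (d z)).2 scalerDr scaler_sumr.
rewrite addrACA -big_split/=; congr (_ + _); apply: eq_bigr => j _.
rewrite !ffunE/= !fctE mulrDr; congr (_ + _); exact: mulrCA.
Qed.

HB.instance Definition _ := GRing.isLinear.Build
  C (Ckvec hab s m) (Ckvec hab s.-1 m) _ Lop Lop_linear.

Variable B : {linear Ckvec hab s m -> 'cV[C]_r}.

(* The product carries the maximum of the two norms, and 'cV[C]_r the maximum
   norm. *)
Definition LB (y : Ckvec hab s m) : (Ckvec hab s.-1 m * 'cV[C]_r)%type :=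
  (Lop y, B y).

Fact LB_linear : linear LB.
Proof. by move=> k y z; rewrite /LB !linearP. Qed.

HB.instance Definition _ := GRing.isLinear.Build
  C (Ckvec hab s m) (Ckvec hab s.-1 m * 'cV[C]_r)%type _ LB LB_linear.

End Operator.

(* Main.v *)
Require Import Defs.
From HB Require Import structures.
From mathcomp Require Import all_boot all_order all_algebra.
From mathcomp Require Import all_classical all_reals.
From mathcomp Require Import topology normedtype complex.
From mathcomp Require Import generic_quotient ring_quotient.
From mathcomp Require Import derive sequences exp measure lebesgue_measure.
From mathcomp Require Import lebesgue_integral ftc.
From mathcomp Require Import ring lra.

(** The map (L, e), with e y = y(a), is a linear bijection from (C^(s))^m onto
    (C^(s-1))^m x C^m: this is the existence, uniqueness and regularity of the
    solution of y' + A y = f, y(a) = c ([ivp_exists], [ivp_unique]).  Replacing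
    e by an arbitrary linear B with values in C^r is then finite-dimensional
    linear algebra.  On ker L, which e identifies with C^m, B acts as an
    m x r matrix M (acting on row vectors), so ker (L, B) is the left kernel of
    M, of dimension m - rank M.  A pair (f, q) is in the image of (L, B) when
    q - B y is in the row space of M, where y solves the equation for f with
    y(a) = 0, so the cokernel is C^r modulo that row space, of dimension
    r - rank M.  The index is m - r ([finite_dim_ker_coker]).

    The initial value problem is solved by successive approximation.  One step
    replaces y by the primitive of f - A y with value c at a, and a mean value
    inequality shows that the step halves distances measured relative to the
    weight exp(2 m k (t - a)), where k bounds the entries of A
    ([contraction]).  This gives uniqueness, and geometric convergence of the
    iterates on the whole of [a, b].  Primitives come from the fundamental
    theorem of calculus for the Lebesgue integral, applied on the line to the
    real and imaginary parts of functions extended by constants outside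
    [a, b].  The equation y' = f - A y then raises the regularity of y one
    order at a time ([solution_regular]).

    Boundedness of L reduces to the inequality
    ||x y||_(l) <= 3^l ||x||_(l) ||y||_(l) ([Ck_norm_mul]). *)

Set Implicit Arguments.
Unset Strict Implicit.
Unset Printing Implicit Defensive.
Import Order.TTheory GRing.Theory Num.Theory.
Local Open Scope ring_scope.

(** * Kernel, cokernel and index by linear algebra *)

(** Composing the two coordinate maps gives an injective linear map, that is a
    row-free matrix, from K^q to K^t. *)
Lemma has_dim_inj (K : fieldType) (V : lmodType K) (n p : nat) :
  has_dim V n -> has_dim V p -> n = p.
Proof.
suff le q t : has_dim V q -> has_dim V t -> (q <= t)%N.
  by move=> Vn Vp; apply/eqP; rewrite eqn_leq !le.
move=> [[f linf [f' fK f'K]]] [[g ling [g' gK g'K]]].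
pose F : {linear V -> 'rV[K]_q} :=
  HB.pack f (GRing.isLinear.Build _ _ _ _ f linf).
pose G : {linear V -> 'rV[K]_t} :=
  HB.pack g (GRing.isLinear.Build _ _ _ _ g ling).
have linf' : linear f'.
  by move=> k u v; apply: (can_inj fK); rewrite linf !f'K.
pose F' : {linear 'rV[K]_q -> V} :=
  HB.pack f' (GRing.isLinear.Build _ _ _ _ f' linf').
pose M := lin1_mx (G \o F').
have : row_free M.
  rewrite -kermx_eq0; apply/rowV0P => v /sub_kermxP; rewrite mul_rV_lin1 /=.
  move=> gv0; have f'v0 : f' v = 0.
    by apply: (can_inj gK); rewrite gv0 (linear0 G : g 0 = 0).
  by rewrite -(f'K v) f'v0 (linear0 F : f 0 = 0).
by rewrite /row_free => /eqP <-; exact: rank_leq_col.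
Qed.

Lemma dimensionE (K : fieldType) (V : lmodType K) (n : nat) :
  has_dim V n -> dimension V = n.
Proof.
move=> Vn; apply: (@has_dim_inj _ V) => //.
by apply: (@xgetPex _ 0%N [set n | has_dim V n]%classic); exists n.
Qed.

Section Index.
Local Open Scope quotient_scope.
Variables (K : fieldType) (X Z : lmodType K) (m r : nat).
Variables (L : {linear X -> Z}) (e : {linear X -> 'rV[K]_m}).
Variables (B : {linear X -> 'cV[K]_r}) (T : {linear X -> (Z * 'cV[K]_r)%type}).
Hypothesis TE : forall x, T x = (L x, B x).
Hypothesis Le_inj : forall x, L x = 0 -> e x = 0 -> x = 0.
Hypothesis Le_surj : forall f c, exists x, L x = f /\ e x = c.

Definition sol f c : X := projT1 (cid (Le_surj f c)).

Lemma L_sol f c : L (sol f c) = f.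
Proof. by rewrite /sol; case: cid => x /= []. Qed.

Lemma e_sol f c : e (sol f c) = c.
Proof. by rewrite /sol; case: cid => x /= []. Qed.

Lemma sol_unique x y : L x = L y -> e x = e y -> x = y.
Proof.
move=> Lxy exy; apply/eqP; rewrite -subr_eq0; apply/eqP.
by apply: Le_inj; rewrite linearB ?Lxy ?exy /= subrr.
Qed.

(** The matrix of B restricted to ker L, in the basis of ker L that e sends to
    the standard basis of K^m. *)
Definition boundary_mx : 'M[K]_(m, r) :=
  \matrix_i (B (sol 0 (delta_mx 0 i)))^T.

Lemma B_ker x : L x = 0 -> (B x)^T = e x *m boundary_mx.
Proof.
move=> Lx.
have -> : B x = \sum_i e x 0 i *: B (sol 0 (delta_mx 0 i)).
  rewrite -[x in LHS](@sol_unique (\sum_i e x 0 i *: sol 0 (delta_mx 0 i))).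
  - by rewrite linear_sum; apply: eq_bigr => i _; rewrite linearZ.
  - rewrite linear_sum Lx big1 // => i _.
    by rewrite linearZ /= L_sol scaler0.
  - rewrite linear_sum [RHS]row_sum_delta; apply: eq_bigr => i _.
    by rewrite linearZ /= e_sol.
rewrite linear_sum mulmx_sum_row; apply: eq_bigr => i _ /=.
by rewrite linearZ /= rowK.
Qed.

(** The coordinates of y in ker T are those of e y, which lies in the kernel of
    the boundary matrix, in a basis of that kernel. *)
Lemma has_dim_ker : has_dim (ker_space T) (\rank (kermx boundary_mx)).
Proof.
set N := row_base (kermx boundary_mx).
have NM0 : N *m boundary_mx = 0.
  by apply/sub_kermxP; rewrite eq_row_base.
have kerP (y : ker_space T) : L (val y) = 0 /\ B (val y) = 0.
  by have /eqP := valP y; rewrite TE => -[].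
have valN c : sol 0 (c *m N) \in ker_pred T.
  rewrite unfold_in TE L_sol; apply/eqP; congr (_, _).
  by apply/trmx_inj; rewrite B_ker ?L_sol// e_sol -mulmxA NM0 mulmx0 trmx0.
have eN (y : ker_space T) : (e (val y) <= N)%MS.
  have [Ly By] := kerP y.
  by rewrite eq_row_base; apply/sub_kermxP; rewrite -B_ker// By trmx0.
constructor; exists (fun y => e (val y) *m pinvmx N).
  move=> k y z; have -> : val (k *: y + z) = k *: val y + val z by [].
  by rewrite linearP /= mulmxDl scalemxAl.
exists (fun c => exist _ (sol 0 (c *m N)) (valN c)) => [y|c] /=.
  apply: val_inj; apply: (@sol_unique (sol 0 _) (val y)).
    by rewrite L_sol (kerP y).1.
  by rewrite e_sol mulmxKpV ?eN.
by rewrite e_sol mulmxKp// row_base_free.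
Qed.

(** What remains of the second component after a solution of L x = f has been
    subtracted from the pair: (f, q) and (0, defect) are equal modulo the image
    of T. *)
Definition defect (p : Z * 'cV[K]_r) : 'rV[K]_r := (p.2 - B (sol p.1 0))^T.

Lemma defect_linear : linear defect.
Proof.
move=> k p q; rewrite /defect /=.
have -> : sol (k *: p.1 + q.1) 0 = k *: sol p.1 0 + sol q.1 0.
  by apply: sol_unique; rewrite linearP ?L_sol// !e_sol scaler0 addr0.
by rewrite linearP opprD addrACA -scalerBr linearP.
Qed.

(** Two solutions of L x = f differ by an element of ker L, on which B takes
    exactly the values in the row space of the boundary matrix. *)
Lemma im_defect p : (p \in im_pred T) = (defect p <= boundary_mx)%MS.
Proof.
case: p => f q; rewrite /defect /=; apply/idP/idP.
  rewrite unfold_in => /set_mem[x _]; rewrite TE => -[<- <-].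
  rewrite -linearB B_ker ?submxMl//.
  by rewrite linearB /= L_sol subrr.
move=> /submxP[c]; set q' := B _ => qE.
rewrite unfold_in; apply/mem_set; exists (sol f c) => //.
rewrite TE L_sol; congr (_, _).
have : (B (sol f c - sol f 0))^T = (q - q')^T.
  rewrite qE B_ker ?linearB /= ?L_sol ?subrr// !e_sol subr0 //.
by move=> /trmx_inj; rewrite linearB => /addIr.
Qed.

(** The quotient by the row space of the boundary matrix M is realized by the
    independent columns Q of cokermx M: a row v is in that space when
    v Q = 0. *)
Lemma has_dim_coker :
  has_dim (coker_space T) (\rank (cokermx boundary_mx)).
Proof.
set Q := col_base (cokermx boundary_mx).
have QP p : (p \in im_pred T) = (defect p *m Q == 0).
  rewrite im_defect submxE.
  have -> : defect p *m cokermx boundary_mx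
      = defect p *m Q *m row_base (cokermx boundary_mx).
    by rewrite -mulmxA mulmx_base.
  by rewrite mulmx_free_eq0// row_base_free.
pose D p := defect p *m Q.
have Dlin k p q : D (k *: p + q) = k *: D p + D q.
  by rewrite /D defect_linear mulmxDl scalemxAl.
have Dpi p q : (\pi_(coker_space T) p == \pi_(coker_space T) q) = (D p == D q).
  rewrite -Quotient.idealrBE QP -/(D _) -[p - q]addrC -scaleN1r Dlin scaleN1r.
  by rewrite addrC subr_eq0.
constructor; exists (fun u : coker_space T => D (repr u)).
  move=> k u v; rewrite -Dlin; apply/eqP; rewrite -Dpi reprK.
  by rewrite pi_cokerD pi_scale_coker !reprK.
have Dsec c : D (0, (c *m pinvmx Q)^T) = c.
  have s0 : sol 0 0 = 0 by apply: sol_unique; rewrite ?L_sol ?e_sol !linear0.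
  rewrite /D /defect /= s0 linear0 subr0 trmxK -mulmxA mulVpmx ?mulmx1//.
  exact: col_base_full.
exists (fun c => \pi_(coker_space T) (0, (c *m pinvmx Q)^T)) => [u|c] /=.
  by rewrite -[RHS]reprK; apply/eqP; rewrite Dpi Dsec.
by rewrite -[RHS]Dsec; apply/eqP; rewrite -Dpi reprK.
Qed.

Lemma finite_dim_ker_coker :
  [/\ finite_dim (ker_space T), finite_dim (coker_space T)
    & (dimension (ker_space T))%:Z - (dimension (coker_space T))%:Z
      = m%:Z - r%:Z].
Proof.
split; [by eexists; exact: has_dim_ker|by eexists; exact: has_dim_coker|].
rewrite (dimensionE has_dim_ker) (dimensionE has_dim_coker).
rewrite mxrank_ker mxrank_coker -!subzn ?rank_leq_row ?rank_leq_col//.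
by rewrite opprB addrA subrK.
Qed.

End Index.

(** * Moduli and limits of complex numbers *)

Lemma continuous_compose (S T U : topologicalType) (f : S -> T) (g : T -> U) :
  continuous f -> continuous g -> continuous (fun s => g (f s)).
Proof. by move=> cf cg s; exact: (continuous_comp (cf s) (cg (f s))). Qed.

Section ComplexModulus.
Local Open Scope classical_set_scope.
Local Open Scope ring_scope.
Local Open Scope complex_scope.
Variable R : realType.
Notation C := (Cx R).

Lemma modulusN (z : C) : modulus (- z) = modulus z.
Proof. by rewrite /modulus normrN. Qed.

Lemma modulus_distC (z w : C) : modulus (z - w) = modulus (w - z).
Proof. by rewrite -modulusN opprB. Qed.

Lemma modulus0 : modulus (0 : C) = 0.
Proof. by rewrite /modulus normr0. Qed.

Lemma modulus1 : modulus (1 : C) = 1.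
Proof. by rewrite /modulus normr1. Qed.

Lemma modulusR (x : R) : modulus (x%:C : C) = `|x|.
Proof. by rewrite /modulus normc_def /= expr0n /= addr0 sqrtr_sqr. Qed.

Lemma Re_le_modulus (z : C) : `|complex.Re z| <= modulus z.
Proof.
rewrite /modulus normc_def /= -sqrtr_sqr ler_wsqrtr// lerDl.
exact: sqr_ge0.
Qed.

Lemma Im_le_modulus (z : C) : `|complex.Im z| <= modulus z.
Proof.
rewrite /modulus normc_def /= -sqrtr_sqr ler_wsqrtr// lerDr.
exact: sqr_ge0.
Qed.

Lemma ReB (z w : C) : complex.Re (z - w) = complex.Re z - complex.Re w.
Proof. by case: z w => [? ?] [? ?]. Qed.

Lemma ImB (z w : C) : complex.Im (z - w) = complex.Im z - complex.Im w.
Proof. by case: z w => [? ?] [? ?]. Qed.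

Lemma modulus_le_ReIm (z : C) :
  modulus z <= `|complex.Re z| + `|complex.Im z|.
Proof.
have {1}-> : z = (complex.Re z)%:C + ('i%C : C) * (complex.Im z)%:C.
  exact: complexE.
apply: le_trans (modulusD _ _) _; rewrite modulusM !modulusR.
have -> : modulus ('i%C : C) = 1.
  by rewrite /modulus normc_def /= expr0n /= add0r expr1n sqrtr1.
by rewrite mul1r.
Qed.

Lemma Re_divr (z : C) (x : R) : complex.Re (z / x%:C) = complex.Re z / x.
Proof.
by rewrite -(fmorphV (real_complex R)); case: z => ? ? /=; rewrite mulr0 subr0.
Qed.

Lemma modulus_sum (J : Type) (s : seq J) (F : J -> C) :
  modulus (\sum_(j <- s) F j) <= \sum_(j <- s) modulus (F j).
Proof.
elim/big_rec2: _ => [|j y z _ IH]; first by rewrite modulus0.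
by apply: le_trans (modulusD _ _) _; rewrite lerD2l.
Qed.

(** Rotating a complex number onto the positive axis turns a bound on real parts
    into a bound on the modulus without loss of a constant. *)
Lemma modulus_phase (z : C) :
  exists2 k : C, modulus k = 1 & k * z = (modulus z)%:C.
Proof.
have [->|z0] := eqVneq z 0.
  by exists 1; rewrite ?modulus1// mulr0 modulus0.
exists (`|z| / z); last by rewrite divfK// normCE.
by rewrite /modulus normf_div normr_id divff ?normr_eq0.
Qed.

(** A positive element of C is real, so limits in C can be tested with real
    tolerances. *)
Lemma cvgC_lt (T : Type) (F : set_system T) (f : T -> C) (l : C) : Filter F ->
  f @ F --> l <-> forall e, 0 < e -> \forall t \near F, modulus (l - f t) < e.
Proof.
move=> FF; split=> [/cvgrPdist_lt fl e e0|fl].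
  have e0' : 0 < (e%:C : C) by rewrite ltcR.
  by have := fl _ e0'; apply: filterS => t; rewrite normCE ltcR.
apply/cvgrPdist_lt => -[e e'] /=; rewrite ltcE /= => /andP[/eqP -> e0].
by apply: filterS (fl e e0) => t; rewrite normCE ltcR.
Qed.

Lemma Re_continuous : continuous (@complex.Re R : C -> R).
Proof.
move=> z; apply/(cvgrPdist_lt (FF := nbhs_filter z)) => e e0.
have zz : (fun w : C => w) @ z --> z by exact: cvg_id.
have := (cvgC_lt (fun w : C => w) z (nbhs_filter z)).1 zz e e0.
apply: filterS => w; apply: le_lt_trans.
by rewrite -ReB; exact: Re_le_modulus.
Qed.

Lemma Im_continuous : continuous (@complex.Im R : C -> R).
Proof.
move=> z; apply/(cvgrPdist_lt (FF := nbhs_filter z)) => e e0.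
have zz : (fun w : C => w) @ z --> z by exact: cvg_id.
have := (cvgC_lt (fun w : C => w) z (nbhs_filter z)).1 zz e e0.
apply: filterS => w; apply: le_lt_trans.
by rewrite -ImB; exact: Im_le_modulus.
Qed.

End ComplexModulus.

(** * Primitives and the mean value inequality on a segment *)

Section Segment.
Local Open Scope classical_set_scope.
Local Open Scope ring_scope.
Local Open Scope complex_scope.
Variables (R : realType) (a b : R) (hab : a < b).
Notation C := (Cx R).
Notation I := (set_type `[a, b]%classic).
Implicit Types (x y : I -> C) (t u : I).

Lemma seg_itv t : a <= \val t <= b.
Proof. by have := valP t; rewrite inE /= in_itv. Qed.

Lemma clamp_in (t : R) : Num.max a (Num.min b t) \in `[a, b]%classic.
Proof.
by rewrite inE /= in_itv /= le_max lexx /= ge_max ge_min lexx (ltW hab).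
Qed.

(** The retraction of the line onto [a, b]; composing with it extends a function
    on the segment continuously to the line, where real functions have
    derivatives and integrals. *)
Definition clamp (t : R) : I :=
  exist (fun s => s \in `[a, b]%classic) _ (clamp_in t).

Lemma clamp_id (t : R) : a <= t <= b -> \val (clamp t) = t.
Proof. by move=> /andP[at_ tb]; rewrite /= (min_idPr tb) (max_idPr at_). Qed.

Lemma clampK t : clamp (\val t) = t.
Proof. by apply: val_inj; rewrite clamp_id// seg_itv. Qed.

Lemma clamp_dist (t u : R) : `|\val (clamp t) - \val (clamp u)| <= `|t - u|.
Proof.
have ab := hab; rewrite /= /Num.max /Num.min.
by case: (ltP b t); case: (ltP b u) => ? ?;
  case: (ltP a t) => ?; case: (ltP a u) => ?;
  rewrite ?ab;
  rewrite ler_norml; case: (ler0P (t - u)) => ?; apply/andP; split; lra.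
Qed.

Lemma nbhs_segP t (P : set I) : nbhs t P <->
  exists2 e : R, 0 < e & forall u, `|\val t - \val u| < e -> P u.
Proof.
split; first by move=> /nbhs_ballP[e /= e0 tA]; exists e.
by move=> [e e0 eP]; apply/nbhs_ballP; exists e.
Qed.

Lemma clamp_continuous : continuous clamp.
Proof.
move=> t P /nbhs_segP[e e0 eP]; apply/nbhs_ballP; exists e => //= u tu.
by apply: eP; apply: le_lt_trans (clamp_dist _ _) tu.
Qed.

Lemma diff_quot_cvgP x t l : diff_quot x t u @[u --> t^'] --> l <->
  forall e, 0 < e -> exists2 d : R, 0 < d &
    forall u, u != t -> `|\val t - \val u| < d ->
      modulus (l - diff_quot x t u) < e.
Proof.
split=> [/cvgC_lt xl e e0|xl].
  have := xl _ e0; rewrite /dnbhs /within /= => /nbhs_segP[d d0 dP].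
  by exists d => // u ut tu; exact: dP.
apply/cvgC_lt => e e0; have [d d0 dP] := xl e e0.
rewrite /dnbhs /within /=; apply/nbhs_segP.
by exists d => // u tu ut; exact: dP.
Qed.


Lemma is_derive_cvgP (g : R -> R) (t l : R) : is_derive t 1 g l <->
  forall e, 0 < e -> exists2 d : R, 0 < d &
    forall u : R, u != t -> `|t - u| < d ->
      `|l - (g u - g t) / (u - t)| < e.
Proof.
pose q (h : R) := h^-1 *: ((g \o shift t) (h *: (1 : R)) - g t).
have qE (h : R) : q h = (g (h + t) - g t) / h.
  by rewrite /q /= [h *: 1]mulr1 [LHS]mulrC.
have dgP : is_derive t 1 g l <-> q h @[h --> 0^'] --> l.
  split=> [[dg <-]|ql]; first exact: dg.
  by split; [exact: (cvgP _ ql)|exact: (cvg_lim (@norm_hausdorff _ _) ql)].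
apply: (iff_trans dgP); split=> [/cvgrPdist_lt ql e e0|ql].
  have := ql _ e0; rewrite /dnbhs /within /= => /nbhs_ballP[d /= d0 dP].
  exists d => // u ut tu; have := dP (u - t).
  rewrite qE subrK subr_eq0; apply => //.
  by rewrite /ball /= sub0r opprB.
apply/cvgrPdist_lt => e e0; have [d d0 dP] := ql e e0.
rewrite /dnbhs /within /=; apply/nbhs_ballP; exists d => // h; rewrite /ball /=.
rewrite sub0r => hd h0; have := dP (h + t); rewrite qE addrK; apply.
  by rewrite -subr_eq0 addrK.
by rewrite opprD addrCA subrr addr0.
Qed.

(** Near an interior point the extended function is the original one, so its
    derivative on the line is the derivative within the segment. *)
Lemma is_derive_Re_clamp x t (l : C) : a < \val t < b ->
  diff_quot x t u @[u --> t^'] --> l ->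
  is_derive (\val t) 1 (fun u : R => complex.Re (x (clamp u))) (complex.Re l).
Proof.
move=> /andP[at_ tb] /diff_quot_cvgP xl; apply/is_derive_cvgP => e e0.
have [d d0 dP] := xl e e0.
(* Points this close to t stay inside the segment. *)
exists (Num.min d (Num.min (\val t - a) (b - \val t))).
  by rewrite !lt_min d0 !subr_gt0 at_ tb.
move=> u ut; rewrite !lt_min.
move=> /and3P[tud /ltr_normlP[tu1 tu2] /ltr_normlP[tu3 tu4]].
have uE : \val (clamp u) = u by apply: clamp_id; apply/andP; split; lra.
have := dP (clamp u); rewrite uE => /(_ _ tud); rewrite clampK => {}dP.
apply: le_lt_trans (dP _); last first.
  by apply: contra_neq ut => <-.
apply: le_trans (Re_le_modulus _); rewrite /diff_quot uE.
by rewrite ReB Re_divr ReB.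
Qed.


(** In the other direction, a derivative on the line restricts to a derivative
    within the segment, one-sided at the endpoints. *)
Lemma diff_quot_real (F : R -> R) t (l : R) : is_derive (\val t) 1 F l ->
  diff_quot (fun u => (F (\val u))%:C : C) t u @[u --> t^'] --> (l%:C : C).
Proof.
move=> /is_derive_cvgP Fl; apply/diff_quot_cvgP => e e0.
have [d d0 dP] := Fl e e0; exists d => // u ut tu.
rewrite /diff_quot -rmorphB -(fmorphV (real_complex R)) -rmorphM -rmorphB.
by rewrite modulusR; apply: dP.
Qed.

(** Integrating over [a - 1, b + 1] makes a and b interior points, so that the
    fundamental theorem applies at the endpoints too. *)
Lemma real_primitive (f : R -> R) : continuous f ->
  exists F : R -> R, forall t : R, a <= t <= b -> is_derive t 1 F (f t).
Proof.
move=> cf.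
exists (fun s : R => parameterized_integral lebesgue_measure (a - 1) s f).
move=> t /andP[at_ tb].
have [] := @continuous_FTC1_closed R f (a - 1) t (b + 1).
- by lra.
- apply: continuous_compact_integrable; first exact: segment_compact.
  exact: continuous_subspaceT.
- by lra.
- exact: cf.
by move=> dF F'; split; rewrite -?derive1E.
Qed.

Lemma primitive x (c : C) : continuous x -> exists X : I -> C,
  X (clamp a) = c /\
  forall t, differentiable_at X t /\ derivative X t = x t.
Proof.
move=> cx.
have cont (g : C -> R) :
    continuous g -> continuous (fun s : R => g (x (clamp s))).
  move=> cg; apply: continuous_compose cg.
  exact: continuous_compose clamp_continuous cx.
have [F1 dF1] := real_primitive (cont _ (@Re_continuous R)).
have [F2 dF2] := real_primitive (cont _ (@Im_continuous R)).
pose X1 (t : I) : C := (F1 (\val t))%:C.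
pose X2 (t : I) : C := (F2 (\val t))%:C.
pose X t := ('i%C : C) * X2 t + X1 t.
exists (fun t => X t - X (clamp a) + c); split; first by rewrite subrr add0r.
move=> t; apply: deriv_unique => //.
have -> : diff_quot (fun t => X t - X (clamp a) + c) t =
    (fun u => ('i%C : C) * diff_quot X2 t u) + diff_quot X1 t.
  apply/funext => u; rewrite /diff_quot !fctE /= mulrA -mulrDl.
  congr (_ / _); rewrite /X; ring.
have d1 : diff_quot X1 t u @[u --> t^'] --> ((complex.Re (x t))%:C : C).
  by apply: diff_quot_real; have := dF1 _ (seg_itv t); rewrite clampK.
have d2 : diff_quot X2 t u @[u --> t^'] --> ((complex.Im (x t))%:C : C).
  by apply: diff_quot_real; have := dF2 _ (seg_itv t); rewrite clampK.
have xE : x t = ('i%C : C) * (complex.Im (x t))%:C + (complex.Re (x t))%:C.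
  by rewrite addrC; exact: complexE.
rewrite [X in _ --> X]xE.
exact: (cvgD (cvgM (cvg_cst ('i%C : C)) d2) d1).
Qed.

Lemma differentiable_at_continuous x :
  (forall t, differentiable_at x t) -> continuous x.
Proof.
move=> dx t; apply/(cvgC_lt x (x t) (nbhs_filter t)) => e e0.
have /diff_quot_cvgP/(_ 1 ltr01)[d d0 dP] := differentiable_cvg (dx t).
pose M := modulus (derivative x t) + 1.
have M0 : 0 < M by rewrite ltr_wpDl ?modulus_ge0.
apply/nbhs_segP; exists (Num.min d (e / M)).
  by rewrite lt_min d0 divr_gt0.
move=> u; rewrite lt_min => /andP[ud ue].
have [->|ut] := eqVneq u t; first by rewrite subrr modulus0.
have tu0 : (\val u - \val t)%:C != 0 :> C.
  rewrite (inj_eq (@complexI R) _ 0) subr_eq0.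
  by apply: contra_neq ut => /val_inj.
have -> : x t - x u = - (diff_quot x t u * (\val u - \val t)%:C).
  by rewrite /diff_quot divfK// opprB.
rewrite modulusN modulusM modulusR distrC.
apply: (@le_lt_trans _ _ (M * `|\val t - \val u|)).
  rewrite ler_wpM2r//.
  have -> : diff_quot x t u =
      derivative x t + (diff_quot x t u - derivative x t).
    by rewrite addrCA subrr addr0.
  apply: le_trans (modulusD _ _) _; rewrite lerD2l modulus_distC.
  exact/ltW/dP.
by rewrite mulrC -ltr_pdivlMr.
Qed.

(** With k the phase of x t - x a, the real part g of k x has |g'| <= h', so
    h - g is nondecreasing on [a, b]; and g t - g a is the modulus of
    x t - x a. *)
Lemma mean_value x (h dh : R -> R) :
  (forall t, differentiable_at x t) ->
  (forall s : R, is_derive s 1 h (dh s)) ->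
  (forall t, modulus (derivative x t) <= dh (\val t)) ->
  forall t, modulus (x t - x (clamp a)) <= h (\val t) - h a.
Proof.
move=> dx hh le_dx t.
have [k k1 kE] := modulus_phase (x t - x (clamp a)).
pose y u := k * x u.
have dy u : diff_quot y u v @[v --> u^'] --> k * derivative x u.
  have -> : diff_quot y u = (fun v => k * diff_quot x u v).
    by apply/funext => v; rewrite /diff_quot /y mulrA mulrBr.
  exact: (cvgM (cvg_cst k) (differentiable_cvg (dx u))).
pose g (s : R) := complex.Re (y (clamp s)).
have dg s : s \in `]a, b[ ->
    is_derive s 1 g (complex.Re (k * derivative x (clamp s))).
  rewrite in_itv /= => sab.
  have sE : \val (clamp s) = s by apply: clamp_id; case/andP: sab => *; lra.
  have := @is_derive_Re_clamp y (clamp s) _ _ (dy _).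
  by rewrite sE; apply.
have cg : continuous g.
  apply: continuous_compose (@Re_continuous R).
  apply: (continuous_compose clamp_continuous).
  apply: differentiable_at_continuous => u.
  by have [] := deriv_unique hab (dy u).
have ch : continuous h.
  move=> s; apply/differentiable_continuous/derivable1_diffP.
  by case: (hh s).
have dG s : s \in `]a, b[ -> is_derive s 1 (h - g)
    (dh s - complex.Re (k * derivative x (clamp s))).
  by move=> /dg gs; exact: is_deriveB.
have at_ := seg_itv t.
have := @ger0_derive1_le_cc R (h - g) a b _ _ _ a (\val t).
rewrite !in_itv /= lexx (ltW hab) at_ => G.
have {G} : (h - g) a <= (h - g) (\val t).
  apply: G => //; last by case/andP: at_.
  - by move=> s /dG [].
  - move=> s sab; rewrite derive1E (@derive_val _ _ _ _ _ _ _ (dG s sab)).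
    rewrite subr_ge0; apply: le_trans (ler_norm _) _.
    apply: le_trans (Re_le_modulus _) _; rewrite modulusM k1 mul1r.
    apply: le_trans (le_dx _) _; rewrite clamp_id//.
    by move: sab; rewrite in_itv /= => /andP[*]; apply/andP; split; lra.
  - apply: continuous_subspaceT => s; exact: (cvgB (ch s) (cg s)).
rewrite !fctE /g clampK.
have : complex.Re (y t - y (clamp a)) = modulus (x t - x (clamp a)).
  by rewrite /y -mulrBr kE.
rewrite ReB; lra.
Qed.

End Segment.

(** * Geometric convergence *)

Section Geometric.
Local Open Scope classical_set_scope.
Local Open Scope ring_scope.
Local Open Scope complex_scope.
Variable R : realType.
Notation C := (Cx R).

Lemma le0_geometric (x K : R) : (forall n, x <= K / 2 ^+ n) -> x <= 0.
Proof.
move=> xK; rewrite leNgt; apply/negP => x0.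
pose n := Num.bound (K / x).
have Kn : K < x * n%:R.
  have K0 : 0 <= K by have := xK 0%N; rewrite expr0 divr1; lra.
  by rewrite mulrC -ltr_pdivrMr//; apply: archi_boundP; rewrite divr_ge0// ltW.
have n2 : n%:R <= 2 ^+ n :> R by rewrite -natrX ler_nat ltnW// ltn_expl.
have := xK n; rewrite ler_pdivlMr ?exprn_gt0// => /le_lt_trans/(_ Kn).
by rewrite ltr_pM2l// ltNge n2.
Qed.

(** With e n = 2 K / 2^n, the intervals [u n - e n, u n + e n] are nested, and l
    is the supremum of their left ends. *)
Lemma geometric_limit (u : nat -> R) (K : R) :
  (forall n, `|u n.+1 - u n| <= K / 2 ^+ n) ->
  exists l, forall n, `|l - u n| <= 2 * K / 2 ^+ n.
Proof.
move=> uK; pose e n := 2 * K / 2 ^+ n.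
have eS n : e n = K / 2 ^+ n + e n.+1.
  have p0 : (2 : R) ^+ n != 0 by rewrite expf_neq0 ?pnatr_eq0.
  by rewrite /e exprS; field; rewrite ?p0 ?pnatr_eq0.
have e0 n : 0 <= e n.
  rewrite /e -mulrA mulr_ge0// (le_trans _ (uK n))//.
have step n : u n - e n <= u n.+1 - e n.+1 /\ u n.+1 + e n.+1 <= u n + e n.
  by have := uK n; rewrite ler_norml eS => /andP[? ?]; split; lra.
have lo p k : u p - e p <= u (p + k)%N - e (p + k)%N.
  elim: k => [|k IH]; first by rewrite addn0.
  by rewrite addnS; apply: le_trans IH (step _).1.
have hi p k : u (p + k)%N + e (p + k)%N <= u p + e p.
  elim: k => [|k IH]; first by rewrite addn0.
  by rewrite addnS; apply: le_trans (step _).2 IH.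
have lohi p q : u p - e p <= u q + e q.
  apply: le_trans (lo p q) _; rewrite addnC; apply: le_trans _ (hi q p).
  by have := e0 (q + p)%N; lra.
exists (sup (range (fun n => u n - e n))) => n.
rewrite ler_distl; apply/andP; split.
  apply: ub_le_sup; last by exists n.
  by exists (u 0%N + e 0%N) => _ [p _ <-].
apply: ge_sup; first by exists (u 0%N - e 0%N), 0%N.
by move=> _ [p _ <-].
Qed.

Lemma geometric_limitC (z : nat -> C) (K : R) :
  (forall n, modulus (z n.+1 - z n) <= K / 2 ^+ n) ->
  exists l : C, forall n, modulus (l - z n) <= 4 * K / 2 ^+ n.
Proof.
move=> zK.
have [l1 l1P] : exists l, forall n, `|l - complex.Re (z n)| <= 2 * K / 2 ^+ n.
  apply: geometric_limit => n; apply: le_trans (zK n).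
  by rewrite -ReB; exact: Re_le_modulus.
have [l2 l2P] : exists l, forall n, `|l - complex.Im (z n)| <= 2 * K / 2 ^+ n.
  apply: geometric_limit => n; apply: le_trans (zK n).
  by rewrite -ImB; exact: Im_le_modulus.
exists (Complex l1 l2) => n; apply: le_trans (modulus_le_ReIm _) _.
rewrite ReB ImB /=.
have -> : 4 * K / 2 ^+ n = 2 * K / 2 ^+ n + 2 * K / 2 ^+ n.
  by rewrite -!mulrA; lra.
exact: lerD.
Qed.

Lemma uniform_limit (T : topologicalType) (S : nat -> T -> C) (y : T -> C)
    (K : R) :
  (forall n, continuous (S n)) ->
  (forall n t, modulus (y t - S n t) <= K / 2 ^+ n) -> continuous y.
Proof.
move=> cS yS t; apply/(cvgC_lt y (y t) (nbhs_filter t)) => e e0.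
have [n nK] : exists n, K / 2 ^+ n < e / 3.
  apply: contrapT => /forallNP nK.
  suff : e / 3 <= 0 by lra.
  by apply: (@le0_geometric _ K) => n; rewrite leNgt; exact/negP.
have e3 : 0 < e / 3 by lra.
have := (cvgC_lt (S n) (S n t) (nbhs_filter t)).1 (cS n t) _ e3.
apply: filterS => u.
have -> : y t - y u = (y t - S n t) + (S n t - S n u) - (y u - S n u) by ring.
have := modulusD (y t - S n t + (S n t - S n u)) (- (y u - S n u)).
have := modulusD (y t - S n t) (S n t - S n u).
rewrite modulusN; have := yS n t; have := yS n u; lra.
Qed.

End Geometric.

(** * The initial value problem *)

Section System.
Local Open Scope classical_set_scope.
Local Open Scope ring_scope.
Local Open Scope complex_scope.
Variables (R : realType) (a b : R) (hab : a < b).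
Notation C := (Cx R).
Notation I := (set_type `[a, b]%classic).
Implicit Types (x y : I -> C) (t u : I).

Lemma derivative_sub x y t : differentiable_at x t -> differentiable_at y t ->
  differentiable_at (fun u => x u - y u) t /\
  derivative (fun u => x u - y u) t = derivative x t - derivative y t.
Proof.
move=> dx dy; have [dyx dyxE] := derivP hab (-1) dy dx.
have -> : (fun u => x u - y u) = -1 *: y + x.
  by apply/funext => u; rewrite !fctE /= scaleN1r addrC.
by split => //; rewrite dyxE mulN1r addrC.
Qed.

Lemma is_Ck_rhs l m x (A y : 'I_m -> I -> C) : is_Ck l x ->
  (forall j, is_Ck l (A j)) -> (forall j, is_Ck l (y j)) ->
  is_Ck l (fun t => x t - \sum_(j < m) A j t * y j t).
Proof.
move=> xl Al yl.
have -> : (fun t => x t - \sum_(j < m) A j t * y j t) =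
    -1 *: (\sum_(j < m) (fun t => A j t * y j t)) + x.
  by apply/funext => t; rewrite !fctE /= fct_sumE scaleN1r addrC.
apply: (is_Ck_lin hab _ _ xl); elim/big_ind: _ => [|u v ul vl|j _].
- exact: is_Ck_0.
- have -> : u + v = (1 : C) *: u + v by rewrite scale1r.
  exact: is_Ck_lin.
- exact: (is_CkM hab (Al j) (yl j)).
Qed.

Variables (m : nat) (A : 'I_m -> 'I_m -> I -> C).
Hypothesis cA : forall i j, continuous (A i j).

(** z is obtained from y by one step of successive approximation for
    y' + A y = f; a solution is a fixed point, [solves f y y]. *)
Definition solves (f y z : 'I_m -> I -> C) := forall i t,
  differentiable_at (z i) t /\
  derivative (z i) t = f i t - \sum_(j < m) A i j t * y j t.

(** Twice m times a bound on all entries of A; the factor 2 is what makes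
    [contraction] gain a factor 1/2. *)
Definition rate : R := 2 * m%:R * \sum_i \sum_j supnorm (A i j).
Definition weight (s : R) : R := expR (rate * (s - a)).

Let A_le i j t : modulus (A i j t) <= \sum_i \sum_j supnorm (A i j).
Proof.
apply: le_trans (le_supnorm t (@cA i j)) _.
rewrite (bigD1 i) //= (bigD1 j) //= -addrA lerDl addr_ge0//.
  by apply: sumr_ge0 => *; exact: supnorm_ge0.
by apply: sumr_ge0 => *; apply: sumr_ge0 => *; exact: supnorm_ge0.
Qed.

Lemma rate_ge0 : 0 <= rate.
Proof.
rewrite /rate !mulr_ge0//.
by apply: sumr_ge0 => *; apply: sumr_ge0 => *; exact: supnorm_ge0.
Qed.

Lemma weight_ge1 t : 1 <= weight (\val t).
Proof.
rewrite -expR0 ler_expR mulr_ge0 ?rate_ge0// subr_ge0.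
by have /andP[] := seg_itv t.
Qed.

Lemma weight_le t : weight (\val t) <= weight b.
Proof.
rewrite ler_expR ler_wpM2l ?rate_ge0// lerB//.
by have /andP[] := seg_itv t.
Qed.

(** The difference z of z1 and z2 satisfies z' = - A (y1 - y2), so |z'| is at
    most m k c w = (c / 2) w', where k is the bound on A used in [rate] and
    w' = 2 m k w; the mean value inequality integrates this. *)
Lemma contraction (f y1 y2 z1 z2 : 'I_m -> I -> C) (c : R) :
  solves f y1 z1 -> solves f y2 z2 ->
  (forall i, z1 i (clamp hab a) = z2 i (clamp hab a)) ->
  (forall j t, modulus (y1 j t - y2 j t) <= c * weight (\val t)) ->
  forall i t, modulus (z1 i t - z2 i t) <= c / 2 * weight (\val t).
Proof.
move=> s1 s2 z12 y12 i t.
pose h s := c / 2 * weight s.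
have dh (s : R) : is_derive s 1 h (c / 2 * (rate * weight s)).
  rewrite /h /weight; apply: is_derive_eq.
  transitivity (c / 2 * (expR (rate * (s - a)) * (rate * (1 - 0)))) => //.
  by rewrite subr0 mulr1 [_ * rate]mulrC.
pose x u := z1 i u - z2 i u.
have dx u : differentiable_at x u /\
    derivative x u = - \sum_(j < m) A i j u * (y1 j u - y2 j u).
  have [d1 e1] := s1 i u; have [d2 e2] := s2 i u.
  have [d e] := derivative_sub d1 d2; split; first exact: d.
  rewrite e e1 e2 opprD addrACA subrr add0r opprK addrC -sumrB -sumrN.
  by apply: eq_bigr => j _; rewrite mulrBr opprB.
have le_dx u : modulus (derivative x u) <= c / 2 * (rate * weight (\val u)).
  rewrite (dx u).2 modulusN; apply: le_trans (modulus_sum _ _) _.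
  set K := \sum_i \sum_j supnorm (A i j).
  apply: (@le_trans _ _ (\sum_(j < m) K * (c * weight (\val u)))).
    apply: ler_sum => j _; rewrite modulusM.
    by apply: ler_pM; rewrite ?modulus_ge0// ?A_le ?y12.
  rewrite sumr_const card_ord -[_ *+ _]mulr_natl /rate -/K.
  by rewrite le_eqVlt; apply/orP; left; apply/eqP; field.
have := mean_value hab (fun u => (dx u).1) dh le_dx t.
rewrite /x z12 subrr subr0 => /le_trans; apply.
rewrite /h gerBl mulr_ge0 ?expR_ge0// divr_ge0//.
have := y12 i t; have := modulus_ge0 (y1 i t - y2 i t).
move=> /le_trans h0 /h0; rewrite pmulr_lge0 //.
exact: lt_le_trans ltr01 (weight_ge1 t).
Qed.

Lemma continuous_le (y : 'I_m -> I -> C) : (forall i, continuous (y i)) ->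
  exists2 M, 0 <= M & forall i t, modulus (y i t) <= M.
Proof.
move=> cy; exists (\sum_i supnorm (y i)).
  by apply: sumr_ge0 => i _; exact: supnorm_ge0.
move=> i t; apply: le_trans (le_supnorm t (@cy i)) _.
rewrite (bigD1 i) //= lerDl; apply: sumr_ge0 => *; exact: supnorm_ge0.
Qed.

Lemma solves_continuous (f y z : 'I_m -> I -> C) i :
  solves f y z -> continuous (z i).
Proof.
by move=> s; apply: differentiable_at_continuous => // t; case: (s i t).
Qed.

(** Two solutions with the same initial value are both fixed by the
    approximation step, so [contraction] halves the bound on their distance
    forever. *)
Lemma solution_unique (f y z : 'I_m -> I -> C) :
  solves f y y -> solves f z z ->
  (forall i, y i (clamp hab a) = z i (clamp hab a)) -> y = z.
Proof.
move=> sy sz yz.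
have cy i : continuous (y i) by exact: solves_continuous sy.
have cz i : continuous (z i) by exact: solves_continuous sz.
have [M1 M10 yM] := continuous_le cy; have [M2 M20 zM] := continuous_le cz.
have bound n : forall i t,
    modulus (y i t - z i t) <= (M1 + M2) / 2 ^+ n * weight (\val t).
  elim: n => [|n IH] i t.
    rewrite expr0 divr1; apply: (@le_trans _ _ (M1 + M2)).
      by apply: le_trans (modulusD _ _) _; rewrite modulusN lerD.
    by rewrite ler_peMr ?weight_ge1// addr_ge0.
  by rewrite exprSr invfM mulrA; exact: contraction sy sz yz IH i t.
apply/funext => i; apply/funext => t; apply/eqP; rewrite -subr_eq0; apply/eqP.
apply/modulus_eq0/eqP; rewrite eq_le modulus_ge0 andbT.
apply: (@le0_geometric _ _ ((M1 + M2) * weight (\val t))) => n.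
by rewrite mulrAC.
Qed.

(** The approximations S n start at 0, and converge geometrically to y by
    [contraction].  The step Phi applied to y is within a bound of order 2^-n of
    S (n + 1), hence of y, for every n; so Phi y = y. *)
Lemma solution_exists (f : 'I_m -> I -> C) (c : 'I_m -> C) :
  (forall i, continuous (f i)) ->
  exists y : 'I_m -> I -> C, solves f y y /\ forall i, y i (clamp hab a) = c i.
Proof.
move=> cf.
(* Phi must be total, so the step is unconstrained when y is not continuous. *)
have step (y : 'I_m -> I -> C) : exists z : 'I_m -> I -> C,
    (forall i, continuous (y i)) ->
    solves f y z /\ forall i, z i (clamp hab a) = c i.
  have [cy|ncy] := pselect (forall i, continuous (y i)); last by exists y.
  have /choice[z zP] : forall i, exists X : I -> C, X (clamp hab a) = c i /\
      forall t, differentiable_at X t /\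
        derivative X t = f i t - \sum_(j < m) A i j t * y j t.
    move=> i; apply: primitive; apply/is_Ck0; apply: is_Ck_rhs => [|j|j].
    - exact/is_Ck0/cf.
    - exact/is_Ck0/cA.
    - exact/is_Ck0/cy.
  exists z => _; split=> [i t|i]; first exact: (zP i).2.
  exact: (zP i).1.
have {step}/choice[Phi PhiP] := step.
pose S n := iter n Phi (fun _ _ => 0).
have cS n : forall i, continuous (S n i).
  elim: n => [|n IH] i; first exact: (@cst_continuous I C 0).
  exact: solves_continuous (PhiP _ IH).1.
have sS n : solves f (S n) (S n.+1) by exact: (PhiP _ (cS n)).1.
have S0 n i : S n.+1 i (clamp hab a) = c i by exact: (PhiP _ (cS n)).2.
have [M M0 SM] := continuous_le (cS 1%N).
have dS n : forall i t,
    modulus (S n.+1 i t - S n i t) <= M / 2 ^+ n * weight (\val t).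
  elim: n => [|n IH] i t.
    rewrite subr0 expr0 divr1; apply: le_trans (SM i t) _.
    by rewrite ler_peMr ?weight_ge1.
  rewrite exprSr invfM mulrA.
  by apply: (contraction (sS n.+1) (sS n)) => // j; rewrite !S0.
pose K := M * weight b.
have dSK n i t : modulus (S n.+1 i t - S n i t) <= K / 2 ^+ n.
  apply: le_trans (dS n i t) _; rewrite mulrAC.
  by rewrite ler_wpM2r ?invr_ge0 ?exprn_ge0// ler_wpM2l// weight_le.
have [y yP] : exists y : 'I_m -> I -> C, forall i t n,
    modulus (y i t - S n i t) <= 4 * K / 2 ^+ n.
  have /choice[y yP] : forall it : 'I_m * I, exists l : C, forall n,
      modulus (l - S n it.1 it.2) <= 4 * K / 2 ^+ n.
    by move=> [i t]; apply: geometric_limitC => n; exact: dSK.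
  by exists (fun i t => y (i, t)) => i t; exact: (yP (i, t)).
have cy i : continuous (y i).
  apply: (@uniform_limit _ _ (fun n => S n i)) => [n|n t]; first exact: cS.
  exact: yP.
have [sy y0] := PhiP y cy.
have K0 : 0 <= K by rewrite mulr_ge0// expR_ge0.
have K4n n : 0 <= 4 * K / 2 ^+ n by rewrite divr_ge0 ?exprn_ge0// mulr_ge0.
exists y; suff yE : Phi y = y by rewrite yE in sy y0.
apply/funext => i; apply/funext => t; apply/eqP; rewrite -subr_eq0; apply/eqP.
apply/modulus_eq0/eqP; rewrite eq_le modulus_ge0 andbT.
apply: (@le0_geometric _ _ (4 * K * weight (\val t) + 4 * K)) => n.
have -> : Phi y i t - y i t = (Phi y i t - S n.+1 i t) - (y i t - S n.+1 i t).
  by ring.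
apply: le_trans (modulusD _ _) _; rewrite modulusN mulrDl; apply: lerD.
  apply: (@le_trans _ _ (4 * K / 2 ^+ n / 2 * weight (\val t))).
    apply: (contraction sy (sS n)) => [j|j u]; first by rewrite y0 S0.
    apply: le_trans (yP j u n) _.
    by rewrite ler_peMr ?weight_ge1.
  rewrite [leRHS]mulrAC ler_wpM2r ?expR_ge0// ler_pdivrMr//.
  by rewrite ler_peMr ?ler1n.
apply: le_trans (yP i t n.+1) _.
have K4 : 0 <= 4 * K by rewrite mulr_ge0.
rewrite ler_wpM2l// lef_pV2 ?posrE ?exprn_gt0//.
by rewrite ler_weXn2l// ler1n.
Qed.

(** Bootstrapping: if y is C^k with k <= l, then so is y' = f - A y, and y is
    C^(k+1). *)
Lemma solution_regular l (f y : 'I_m -> I -> C) :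
  (forall i, is_Ck l (f i)) -> (forall i j, is_Ck l (A i j)) ->
  solves f y y -> forall i, is_Ck l.+1 (y i).
Proof.
move=> fl Al sy.
have dyE i : derivative (y i) = fun t => f i t - \sum_(j < m) A i j t * y j t.
  by apply/funext => t; case: (sy i t).
have cy i : continuous (y i) by exact: solves_continuous sy.
have bootstrap k : (forall i, is_Ck k (f i)) ->
    (forall i j, is_Ck k (A i j)) -> (forall i, is_Ck k (y i)) ->
    forall i, is_Ck k.+1 (y i).
  move=> fk Ak yk i; apply/is_CkS; split.
  - by move=> t; case: (sy i t).
  - exact: cy.
  - by rewrite dyE; exact: (is_Ck_rhs (fk i) (Ak i) yk).
elim: l fl Al => [|l IH] fl Al; apply: bootstrap.
- exact: fl.
- exact: Al.
- by move=> i; exact/is_Ck0.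
- exact: fl.
- exact: Al.
- by apply: IH => [i|i j]; exact: is_CkW.
Qed.

End System.

(** * Norms of derivatives and products *)

Section CkOperations.
Local Open Scope classical_set_scope.
Local Open Scope ring_scope.
Local Open Scope complex_scope.
Variables (R : realType) (a b : R) (hab : a < b).
Notation C := (Cx R).
Notation Ck l := (Ckspace hab l).

Lemma Ck_deriv_subproof l (x : Ck l.+1) : derivative x \in Ck_pred hab l.
Proof. by apply/asboolP; case/is_CkS: (Ckspace_is_Ck x). Qed.
Definition Ck_deriv l (x : Ck l.+1) : Ck l := MkCk (Ck_deriv_subproof x).

Lemma Ck_incl_subproof l (x : Ck l.+1) : Ckfun x \in Ck_pred hab l.
Proof. by apply/asboolP/is_CkW; exact: Ckspace_is_Ck. Qed.
Definition Ck_incl l (x : Ck l.+1) : Ck l := MkCk (Ck_incl_subproof x).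

Lemma Ck_mul_subproof l (x y : Ck l) : (fun t => x t * y t) \in Ck_pred hab l.
Proof. by apply/asboolP/is_CkM => //; exact: Ckspace_is_Ck. Qed.
Definition Ck_mul l (x y : Ck l) : Ck l := MkCk (Ck_mul_subproof x y).

Lemma Ck_continuous l (x : Ck l) : continuous x.
Proof. exact: (Ckspace_is_Ck x).2 0%N (leq0n l). Qed.

Lemma Ck_normE l (x : Ck l) :
  `|x| = (\sum_(j < l.+1) supnorm (nderiv j x))%:C :> C.
Proof. by []. Qed.

Lemma Ck_norm0 (x : Ck 0) : `|x| = (supnorm x)%:C :> C.
Proof. by rewrite Ck_normE big_ord1. Qed.

Lemma Ck_normS l (x : Ck l.+1) :
  `|x| = (supnorm x)%:C + `|Ck_deriv x| :> C.
Proof.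
rewrite !Ck_normE big_ord_recl rmorphD /=; congr (_ + _%:C).
by apply: eq_bigr => j _; rewrite /nderiv -iterSr.
Qed.

Lemma Ck_norm_incl l (x : Ck l.+1) : `|Ck_incl x| <= `|x| :> C.
Proof.
rewrite !Ck_normE lecR [leRHS]big_ord_recr /= lerDl; apply: supnorm_ge0 => //.
exact: ((Ckspace_is_Ck x).2 l.+1 (leqnn _)).
Qed.

Lemma supnorm_le_norm l (x : Ck l) : (supnorm x)%:C <= `|x| :> C.
Proof.
case: l x => [|l] x; first by rewrite Ck_norm0.
by rewrite Ck_normS lerDl.
Qed.

Lemma Ck_norm_deriv l (x : Ck l.+1) : `|Ck_deriv x| <= `|x| :> C.
Proof.
by rewrite Ck_normS lerDr ler0c; apply: supnorm_ge0 => //; exact: Ck_continuous.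
Qed.

Lemma supnormM l (x y : Ck l) : supnorm (Ck_mul x y) <= supnorm x * supnorm y.
Proof.
apply: ge_sup.
  by exists (modulus (Ck_mul x y (clamp hab a))), (clamp hab a).
move=> _ [t _ <-] /=; rewrite modulusM.
by apply: ler_pM; rewrite ?modulus_ge0//; apply: le_supnorm;
  exact: Ck_continuous.
Qed.

Lemma Ck_deriv_mul l (x y : Ck l.+1) :
  Ck_deriv (Ck_mul x y) =
    Ck_mul (Ck_incl x) (Ck_deriv y) + Ck_mul (Ck_deriv x) (Ck_incl y).
Proof.
apply/val_inj/funext => t /=.
have d (z : Ck l.+1) : differentiable_at z t.
  by exact: (Ckspace_is_Ck z).1 0%N _ t.
by have [_ ->] := Defs.derivM hab (@Ck_continuous _ x) (d x) (d y).
Qed.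

(** Induction on l through ||x||_(l+1) = ||x||_(0) + ||x'||_(l) and Leibniz:
    each of the three terms of ||x y||_(0) + ||x y'||_(l) + ||x' y||_(l) is at
    most 3^l ||x||_(l+1) ||y||_(l+1). *)
Lemma Ck_norm_mul l (x y : Ck l) : `|Ck_mul x y| <= 3 ^+ l * `|x| * `|y| :> C.
Proof.
have sM l' (u v : Ck l') : (supnorm (Ck_mul u v))%:C <= `|u| * `|v| :> C.
  apply: (@le_trans _ _ ((supnorm u)%:C * (supnorm v)%:C)).
    by rewrite -rmorphM lecR; exact: supnormM.
  apply: ler_pM; rewrite ?ler0c ?supnorm_le_norm//;
    by apply: supnorm_ge0 => //; exact: Ck_continuous.
elim: l x y => [|l IH] x y; first by rewrite Ck_norm0 expr0 mul1r.
have IHxy (u v : Ck l) : `|u| <= `|x| :> C -> `|v| <= `|y| :> C ->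
    `|Ck_mul u v| <= 3 ^+ l * `|x| * `|y| :> C.
  move=> ux vy; apply: le_trans (IH u v) _; rewrite -!mulrA.
  by rewrite ler_wpM2l ?exprn_ge0// ler_pM.
rewrite Ck_normS Ck_deriv_mul.
apply: le_trans (lerD (sM _ x y) (ler_normD _ _)) _.
have h1 := IHxy _ _ (Ck_norm_incl x) (Ck_norm_deriv y).
have h2 := IHxy _ _ (Ck_norm_deriv x) (Ck_norm_incl y).
apply: le_trans (lerD (lexx _) (lerD h1 h2)) _.
rewrite -!mulrA; set p := `|x| * `|y|.
have p0 : 0 <= p by rewrite mulr_ge0.
have -> : 3 ^+ l.+1 * p = 3 ^+ l * p + (3 ^+ l * p + 3 ^+ l * p).
  by rewrite exprS; ring.
by rewrite lerD2r ler_peMl// exprn_ege1// ler1n.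
Qed.

End CkOperations.

(** * The differential operator *)

Section DifferentialOperator.
Local Open Scope classical_set_scope.
Local Open Scope ring_scope.
Local Open Scope complex_scope.
Variables (R : realType) (a b : R) (hab : a < b) (m l : nat).
Notation C := (Cx R).
Variable hs : (0 < l.+1)%N.
Variable A : 'M[Ckspace hab l]_m.
Notation L := (@Lop R a b hab m l.+1 hs A).

Lemma LopE (y : Ckvec hab l.+1 m) i :
  L y i = Ck_deriv (y i) + \sum_j Ck_mul (A i j) (Ck_incl (y j)).
Proof.
apply/val_inj/funext => t; rewrite ffunE /= /Lfun !fctE; congr (_ + _).
have -> : Ckfun (\sum_j Ck_mul (A i j) (Ck_incl (y j))) t =
   \sum_j Ckfun (Ck_mul (A i j) (Ck_incl (y j))) t; last by [].
by elim/big_rec2: _ => [//|j u v _ <-].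
Qed.

Lemma Lop_bounded :
  exists2 M : C, 0 <= M & forall y, `|L y| <= M * `|y|.
Proof.
exists (\sum_i (1 + \sum_j 3 ^+ l * `|A i j|)).
  apply: sumr_ge0 => i _; rewrite addr_ge0// sumr_ge0// => j _.
  by rewrite mulr_ge0// exprn_ge0.
move=> y.
have le_y i : `|y i| <= `|y| :> C.
  have -> : `|y| = \sum_i `|y i| :> C by [].
  by rewrite (bigD1 i)//= lerDl sumr_ge0.
have -> : `|L y| = \sum_i `|L y i| :> C by [].
rewrite mulr_suml; apply: ler_sum => i _; rewrite LopE mulrDl mul1r.
apply: le_trans (ler_normD _ _) _; apply: lerD.
  exact: le_trans (Ck_norm_deriv _) (le_y i).
apply: le_trans (ler_norm_sum _ _ _) _; rewrite mulr_suml.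
apply: ler_sum => j _; apply: le_trans (Ck_norm_mul _ _) _.
rewrite ler_wpM2l ?mulr_ge0 ?exprn_ge0//.
exact: le_trans (Ck_norm_incl _) (le_y j).
Qed.

Lemma Lop_solves (y : Ckvec hab l.+1 m) :
  solves (fun i j => A i j) (fun i => L y i) (fun i => y i) (fun i => y i).
Proof.
move=> i t; split; first exact: (Ckspace_is_Ck (y i)).1 0%N hs t.
by rewrite ffunE /= /Lfun addrK.
Qed.

Definition initial_value (y : Ckvec hab l.+1 m) : 'rV[C]_m :=
  \row_i y i (clamp hab a).

Lemma initial_value_linear : linear initial_value.
Proof. by move=> k y z; apply/rowP => i; rewrite !mxE !ffunE. Qed.
HB.instance Definition _ := GRing.isLinear.Build
  C (Ckvec hab l.+1 m) 'rV[C]_m _ initial_value initial_value_linear.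

(** Both y and 0 solve the homogeneous system with initial value 0. *)
Lemma ivp_unique y : L y = 0 -> initial_value y = 0 -> y = 0.
Proof.
move=> Ly y0; apply/ffunP => i; apply: val_inj.
have := Lop_solves y; have := Lop_solves 0.
rewrite Ly linear0 => s0 sy.
have cA i' j : continuous (A i' j) by exact: Ck_continuous.
have yz i' : y i' (clamp hab a) = (0 : Ckvec hab l.+1 m) i' (clamp hab a).
  by have /rowP/(_ i') := y0; rewrite !mxE ffunE => ->.
exact: (congr1 (fun h => h i) (solution_unique cA sy s0 yz)).
Qed.

Lemma ivp_exists (f : Ckvec hab l m) (c : 'rV[C]_m) :
  exists y, L y = f /\ initial_value y = c.
Proof.
have cA i j : continuous (A i j) by exact: Ck_continuous.
have [y [sy y0]] := solution_exists hab cA (fun i => c 0 i)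
  (fun i => @Ck_continuous _ _ _ hab _ (f i)).
have yC : forall i, is_Ck l.+1 (y i).
  apply: (solution_regular hab _ _ sy) => *; exact: Ckspace_is_Ck.
have yC' i : y i \in Ck_pred hab l.+1 by exact/asboolP.
exists [ffun i => MkCk (yC' i)]; split.
  apply/ffunP => i; apply/val_inj/funext => t; rewrite ffunE /= /Lfun.
  rewrite ffunE /= (sy i t).2 -[RHS](subrK (\sum_j A i j t * y j t)).
  by congr (_ + _); apply: eq_bigr => j _; rewrite ffunE.
by apply/rowP => i; rewrite mxE ffunE /= y0.
Qed.

End DifferentialOperator.

Theorem mainTheorem1 (R : realType) (a b : R) (hab : a < b)
    (m r s : nat) (hm : (0 < m)%N) (hr : (0 < r)%N) (hs : (0 < s)%N)
    (A : 'M[Ckspace hab s.-1]_m)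
    (B : {linear Ckvec hab s m -> 'cV[Cx R]_r}) (hB : continuous B) :
  [/\ bounded_operator (LB hs A B),
      fredholm (LB hs A B)
    & fredholm_index (LB hs A B) = m%:Z - r%:Z].
Proof.
case: s hs A B hB => [//|l] hs A B hB.
have [ML ML0 LM] := Lop_bounded hs A.
have [MB MB0 BM] : exists2 M : Cx R, 0 < M & forall y, `|B y| <= M * `|y|.
  exact/pinfty_ex_gt0/linear_boundedP/linear_bounded_continuous.
have M0 : 0 <= ML + MB by rewrite addr_ge0// ltW.
have LBM y : `|LB hs A B y| <= (ML + MB) * `|y|.
  rewrite prod_normE /= /Num.max; case: ifP => _.
    by apply: le_trans (BM y) _; rewrite ler_wpM2r// lerDr.
  by apply: le_trans (LM y) _; rewrite ler_wpM2r// lerDl ltW.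
have [kerT cokerT index] := @finite_dim_ker_coker _ _ _ _ _ (Lop hs A)
  (initial_value (l := l)) B (LB hs A B) (fun=> erefl)
  (@ivp_unique _ _ _ _ _ _ hs A) (@ivp_exists _ _ _ _ _ _ hs A).
split; [by exists (ML + MB)|split=> //|exact: index].
apply: bounded_linear_continuous; apply/bounded_funP => q.
exists ((ML + MB) * q) => y yq; apply: le_trans (LBM y) _.
by rewrite ler_wpM2l.
Qed.
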